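(* Let $x\in\{0,1\}^{\mathbb{Z}^2}$ be strongly recurrent. Then exactly one of the following alternatives holds. (i) $x$ is doubly periodic, in which case $p_x^{*\mathrm{ab}}(k)\leq[\mathbb{Z}^2:\operatorname{Per}(x)]$ for all positive integers $k$; (ii) $x$ is not doubly periodic, in which case $p_x^{*\mathrm{ab}}(k)=k+1$ for all positive integers $k$.
   Context: For a finite set $S\subset\mathbb{Z}^2$ and $t\in\mathbb{Z}^2$, the $S$-factor of $x$ at $t$ is $x[t+S]=(x(t+s))_{s\in S}$. Two $S$-factors are Abelian equivalent if each letter occurs the same number of times in both. Let $p_x^{\mathrm{ab}}(S)$ be the number of Abelian equivalence classes of $S$-factors of $x$ (over all $t\in\mathbb{Z}^2$), and $p_x^{*\mathrm{ab}}(k)=\sup\{p_x^{\mathrm{ab}}(S): S\subset\mathbb{Z}^2,\ \#S=k\}$. $\operatorname{Per}(x)=\{p\in\mathbb{Z}^2: x(t+p)=x(t)\ \forall t\in\mathbb{Z}^2\}$, a subgroup of $\mathbb{Z}^2$; $x$ is doubly periodic if $\operatorname{Per}(x)$ contains two linearly independent vectors. $[\mathbb{Z}^2:H]$ is the index of a subgroup $H$. $\mathbb{P}^1(\mathbb{R})$ is the set of lines through $0$ in $\mathbb{R}^2$; $\operatorname{dir}(q)=\mathbb{R}q$ for $q\neq0$; identifying $\mathbb{P}^1(\mathbb{R})$ with $\mathbb{R}/\pi\mathbb{Z}$ by angle, $d_\pi([\theta],[\phi])=\min_{m\in\mathbb{Z}}|\theta-\phi-m\pi|$. Let $\Sigma_N=[-N,N]^2\cap\mathbb{Z}^2$.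 $x$ is strongly recurrent if there is $\delta>0$ such that for every $N\geq1$ there are nonzero $u_N,v_N\in\mathbb{Z}^2$ with $x(z+u_N)=x(z)=x(z+v_N)$ for all $z\in\Sigma_N$ and $d_\pi(\operatorname{dir}(u_N),\operatorname{dir}(v_N))\geq\delta$. *)

(* Defs.v *)
From mathcomp Require Import all_boot all_order all_algebra finmap.
From mathcomp Require Import all_classical all_reals all_analysis.

Set Implicit Arguments.
Unset Strict Implicit.
Unset Printing Implicit Defensive.

Import Order.TTheory GRing.Theory Num.Theory.
Import numFieldNormedType.Exports.

Local Open Scope classical_set_scope.
Local Open Scope ring_scope.

Notation Z2 := (int * int)%type.

Section AbelianComplexity.
Context {A : finType}.
Implicit Types (x : Z2 -> A) (S : {fset Z2}).

Definition factor x S (t : Z2) : {ffun S -> A} :=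
  [ffun s : S => x (t + fsval s)].

Definition factors x S : {set {ffun S -> A}} :=
  [set w | `[< exists t : Z2, w = factor x S t >]]%SET.

Definition ab_equiv S : rel {ffun S -> A} := fun v w =>
  [forall a : A, #|[set s | v s == a]%SET| == #|[set s | w s == a]%SET|].

Definition pab x S : nat :=
  #|equivalence_partition (@ab_equiv S) (factors x S)|.

Definition pab_star (R : realType) x (k : nat) : \bar R :=
  ereal_sup [set (pab x S)%:R%:E | S in [set S : {fset Z2} | #|` S|%fset = k]].

End AbelianComplexity.

Definition Per (A : Type) (x : Z2 -> A) : set Z2 :=
  [set p | forall t, x (t + p) = x t].

Definition lin_indep (p q : Z2) : Prop :=
  forall a b : int, p *~ a + q *~ b = 0 -> a = 0 /\ b = 0.

Definition doubly_periodic (A : Type) (x : Z2 -> A) : Prop :=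
  exists p q : Z2, [/\ Per x p, Per x q & lin_indep p q].

Definition cosets (H : set Z2) : set (set Z2) :=
  [set [set t + h | h in H] | t in [set: Z2]].

(* [counting] is +oo on infinite sets, so an infinite index is +oo. *)
Definition subgroup_index (R : realType) (H : set Z2) : \bar R := counting (cosets H).

Section Directions.
Context {R : realType}.

Definition line (theta : R) : set (R * R) :=
  [set (r * cos theta, r * sin theta) | r in [set: R]].

Definition dir (q : Z2) : set (R * R) :=
  [set (r * (q.1)%:~R, r * (q.2)%:~R) | r in [set: R]].

(* The angle of a line through 0 is only defined modulo pi: this is a choice of
   representative, and [dpi] does not depend on it. *)
Definition angle (L : set (R * R)) : R := xget 0 [set theta | line theta = L].

(* The infimum is attained, hence is the minimum over m. *)
Definition dpi (L M : set (R * R)) : R :=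
  inf [set `|angle L - angle M - m%:~R * pi| | m in [set: int]].

End Directions.

Definition Sigma (N : nat) : set Z2 :=
  [set z | (- N%:Z <= z.1 <= N%:Z) && (- N%:Z <= z.2 <= N%:Z)].

Definition strongly_recurrent (R : realType) (A : Type) (x : Z2 -> A) : Prop :=
  exists2 delta : R, 0 < delta &
    forall N : nat, (1 <= N)%N ->
      exists u v : Z2,
        [/\ u <> 0, v <> 0,
            forall z, Sigma N z -> x (z + u) = x z /\ x z = x (z + v)
          & delta <= dpi (dir u) (dir v)].

(* Main.v *)
(** The counts 0, ..., k all occur in the translates of S as soon as the relation
    x (t + s) contains a k-ladder (half-graph), so suppose it contains none:
    iterated limits of x (t_i + s_j) along an ultrafilter then commute. Strong
    recurrence and aperiodicity give w_n outside Per x with x (z + w_n) -> x z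
    for all z, and a_n with x (a_n + w_n) <> x a_n. The limits
    A s = lim x (a_n + s) and B s = lim x (a_n + w_n + s) satisfy A 0 <> B 0 and,
    by commutation of limits, are again recurrent along w_n. Hence the n_i can be
    chosen greedily so that A and B are constant on the partial sums
    q_j = w_{n_1} + ... + w_{n_j}, and then x (a_{n_i} + q_j) is A 0 for j < i
    and B 0 for j >= i: a ladder after all. *)

Require Import Defs.
From mathcomp Require Import all_boot all_order all_algebra finmap.
From mathcomp Require Import all_classical all_reals all_analysis.
From mathcomp Require Import zify.

Import Order.TTheory GRing.Theory Num.Theory.

Set Implicit Arguments.
Unset Strict Implicit.
Unset Printing Implicit Defensive.

Local Open Scope ring_scope.
Local Open Scope classical_set_scope.

(** * Ultrafilter limits and ladders *)

Lemma near_ltn {T : Type} {U : set_system T} {FU : Filter U} (n : nat)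
    (P : nat -> T -> Prop) :
  (forall i, (i < n)%N -> \forall u \near U, P i u) ->
  \forall u \near U, forall i, (i < n)%N -> P i u.
Proof.
move=> nearP.
have := @filter_forall _ _ (fun i : 'I_n => P i) U FU (fun i => nearP i (ltn_ord i)).
by apply: filterS => u Pu i lt_i_n; exact: (Pu (Ordinal lt_i_n)).
Qed.

Lemma ultra_bool_lim {T : Type} {U : set_system T} (UU : UltraFilter U)
    (f : T -> bool) :
  exists b, \forall n \near U, f n = b.
Proof.
have [Uf|Uf] := in_ultra_setVsetC [set n | f n] UU.
  by exists true.
by exists false; apply: filterS Uf => n /= /negP/negbTE.
Qed.

Lemma ultra_lim_translates {G : zmodType} {T : Type} {U : set_system T}
    (UU : UltraFilter U) (x : G -> bool) (c : T -> G) :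
  exists C : G -> bool, forall s, \forall n \near U, x (c n + s) = C s.
Proof.
have [C limC] := choice (fun s => ultra_bool_lim UU (fun n => x (c n + s))).
by exists C.
Qed.

(** A half-graph up to complement: [b] is the common value for [j <= i], left free since a failure
    of limit exchange does not fix which value comes first. *)
Definition ladder (I J : Type) (R : I -> J -> bool) (m : nat) : Prop :=
  exists (b : bool) (t : nat -> I) (s : nat -> J),
    forall i j, (i < m)%N -> (j < m)%N -> R (t i) (s j) = b (+) (i < j)%N.

(* A ladder is what a failure of Grothendieck's double limit criterion produces. *)
Lemma ladder_of_double_limit {T : pointedType} {U : set_system T} (PU : ProperFilter U)
    (R : T -> T -> bool) (b : bool) (m : nat) :
  (\forall i \near U, \forall j \near U, R i j = ~~ b) ->
  (\forall j \near U, \forall i \near U, R i j = b) ->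
  ladder R m.
Proof.
move=> limij limji.
(* The induction carries along that each chosen row and column has its generic limit value, so that
   the next ones can be chosen compatibly. *)
suff [t [s [_ _ Rts]]] : exists (t s : nat -> T),
    [/\ forall i, (i < m)%N -> \forall j \near U, R (t i) j = ~~ b,
        forall j, (j < m)%N -> \forall i \near U, R i (s j) = b
      & forall i j, (i < m)%N -> (j < m)%N -> R (t i) (s j) = b (+) (i < j)%N].
  by exists b, t, s.
elim: m => [|m [t [s [limt lims Rts]]]].
  by exists (fun=> point), (fun=> point).
(* The new column is chosen first, against the old rows; the new row is then chosen against all
   columns, the new one included. *)
have [s' [lims' Rts']] := filter_ex (filterI limji (near_ltn limt)).
have [t' [[limt' Rs'] Rt's]] := filter_ex (filterI (filterI limij lims') (near_ltn lims)).
exists (fun i => if i == m then t' else t i), (fun j => if j == m then s' else s j).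
split=> [i|j|i j]; rewrite ?[(i < m.+1)%N]ltnS ?[(j < m.+1)%N]ltnS
  ?[(i <= m)%N]leq_eqVlt ?[(j <= m)%N]leq_eqVlt.
- by case: eqP => //= _; exact: limt.
- by case: eqP => //= _; exact: lims.
- case: (eqVneq i m) => [->|_] /= Hi; case: (eqVneq j m) => [->|_] /= Hj.
  + by rewrite ltnn addbF.
  + by rewrite Rt's// ltnNge (ltnW Hj) addbF.
  + by rewrite Rts'// Hi addbT.
  + exact: Rts.
Qed.

(** In [x (c i + s + w j)], letting [j] and then [i] run along [U] gives [C s], while the other
    order gives the limit of [C (s + w j)]. If these differ, the double limit criterion yields a
    ladder. *)
Lemma recurrent_lim_translates {G : zmodType} {T : pointedType} {U : set_system T}
    (UU : UltraFilter U) (x : G -> bool) (w c : T -> G) (C : G -> bool) (m : nat) :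
  ~ ladder (fun t s : G => x (t + s)) m ->
  (forall z, \forall n \near U, x (z + w n) = x z) ->
  (forall s, \forall n \near U, x (c n + s) = C s) ->
  forall s, \forall n \near U, C (s + w n) = C s.
Proof.
move=> noladder recw limC s.
have [b limb] := ultra_bool_lim UU (fun n => C (s + w n)).
have [<-//|neq_b] := eqVneq b (C s); case: noladder.
have [b' [t [r Rtr]]] : ladder (fun i j => x (c i + s + w j)) m.
  apply: (@ladder_of_double_limit _ U _ _ b).
    apply: filterS (limC s) => i xi; apply: filterS (recw (c i + s)) => j ->.
    by rewrite xi; case: (C s) (b) neq_b => [] [].
  apply: filterS limb => j <-; apply: filterS (limC (s + w j)) => i.
  by rewrite addrA.
by exists b', (fun i => c (t i) + s), (fun j => w (r j)).
Qed.

Lemma ladder_of_recurrence {G : zmodType} {T : pointedType} {U : set_system T}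
    (UU : UltraFilter U) (x : G -> bool) (w a : T -> G) (m : nat) :
  (forall z, \forall n \near U, x (z + w n) = x z) ->
  (forall n, x (a n + w n) <> x (a n)) ->
  ladder (fun t s : G => x (t + s)) m.
Proof.
move=> recw neqa; apply: contrapT => noladder; apply: (noladder).
have [A limA] := ultra_lim_translates UU x a.
have [B limB] := ultra_lim_translates UU x (fun n => a n + w n).
have recA := recurrent_lim_translates UU noladder recw limA.
have recB := recurrent_lim_translates UU noladder recw limB.
have AB : B 0 = ~~ A 0.
  have [n [/= + +]] := filter_ex (filterI (limA 0) (limB 0)).
  rewrite !addr0 => <- <-; have := neqa n.
  by case: (x (a n)) (x (a n + w n)) => [] [].
(* There is one column more than rows: [q 0] to [q m] against [t 0] to [t m.-1]. The last column
   [q m] is the base point for the next extension. *)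
suff [t [q [_ _ xtq]]] : exists t q : nat -> G,
    [/\ forall j, (j < m.+1)%N -> A (q j) = A 0,
        forall j, (j < m.+1)%N -> B (q j) = B 0
      & forall i j, (i < m)%N -> (j < m.+1)%N -> x (t i + q j) = A 0 (+) (i < j)%N].
  by exists (A 0), t, q => i j im jm; apply: xtq => //; exact: ltnW.
elim: m {noladder} => [|m [t [q [Aq Bq xtq]]]].
  by exists (fun=> 0), (fun=> 0).
(* For such an [n], the new row is [a n] and the new column [q m + w n]. The third condition gives
   the new corner, the fourth the old rows at the new column, the fifth the new row at the old
   columns. *)
have : \forall n \near U, [/\ A (q m + w n) = A (q m), B (q m + w n) = B (q m),
    x (a n + w n + q m) = B (q m),
    forall i, (i < m)%N -> x (t i + q m + w n) = x (t i + q m)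
  & forall j, (j < m.+1)%N -> x (a n + q j) = A (q j)].
  have neart : \forall n \near U, forall i, (i < m)%N ->
      x (t i + q m + w n) = x (t i + q m).
    by apply: near_ltn => i _; exact: recw.
  have nearq : \forall n \near U, forall j, (j < m.+1)%N ->
      x (a n + q j) = A (q j).
    by apply: near_ltn => j _; exact: limA.
  apply: filterS (filterI (filterI (recA (q m)) (recB (q m)))
    (filterI (limB (q m)) (filterI neart nearq))).
  by move=> n [[? ?] [? [? ?]]].
move=> near_n; have [n [Aqw Bqw xB xt xa]] := filter_ex near_n.
exists (fun i => if i == m then a n else t i).
exists (fun j => if j == m.+1 then q m + w n else q j).
split=> [j|j|i j]; rewrite [(j < m.+2)%N]ltnS [(j <= m.+1)%N]leq_eqVlt.
- by case: eqP => [_ _|_ /=]; [rewrite Aqw Aq | exact: Aq].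
- by case: eqP => [_ _|_ /=]; [rewrite Bqw Bq | exact: Bq].
rewrite [(i < m.+1)%N]ltnS [(i <= m)%N]leq_eqVlt.
case: (eqVneq i m) => [->|_] /= Hi; case: (eqVneq j m.+1) => [->|_] /= Hj.
+ by rewrite ltnSn addbT [q m + _]addrC addrA xB Bq// AB.
+ by rewrite xa// Aq// ltnNge -ltnS Hj addbF.
+ by rewrite addrA xt// xtq// ltnS (ltnW Hi) Hi.
+ by rewrite xtq.
Qed.

(** * Directions, periods and recurrence *)

Lemma dependent_of_lin_indepN (u v : Z2) : ~ lin_indep u v ->
  exists a b : int, (a, b) <> 0 /\ u *~ a + v *~ b = 0.
Proof.
move=> /existsNP[a /existsNP[b /not_implyP[uv ab]]].
by exists a, b; split=> // -[a0 b0]; apply: ab.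
Qed.

Lemma mulrz_pair (u : Z2) (a : int) : u *~ a = (u.1 *~ a, u.2 *~ a).
Proof.
have nat_case n : u *+ n = (u.1 *+ n, u.2 *+ n).
  by elim: n => [//|n IHn]; rewrite !mulrS IHn.
by case: a => n; rewrite ?NegzE ?mulrNz -!pmulrn nat_case.
Qed.

Lemma dir_sub (R : realType) (u v : Z2) (a b : int) :
  v <> 0 -> (a, b) <> 0 -> u *~ a + v *~ b = 0 ->
  dir u `<=` (dir v : set (R * R)).
Proof.
move=> v0 ab0; rewrite !mulrz_pair => -[uv1 uv2].
(* Otherwise [b] is nonzero and kills [v]. With [a] invertible, [u] is [- (b / a)] times [v] over
   the reals. *)
have a0 : a != 0.
  apply/eqP => a0; move: uv1 uv2; rewrite a0 !mulr0z !add0r.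
  rewrite !mulrzz => /eqP + /eqP; rewrite !mulf_eq0.
  have [b0|_] := eqVneq b 0; first by rewrite a0 b0 in ab0.
  rewrite !orbF => /eqP v1 /eqP v2.
  by apply: v0; case: v v1 v2 => ? ? /= -> ->.
have aR0 : a%:~R != 0 :> R by rewrite intr_eq0.
have coord (c d : int) : c *~ a + d *~ b = 0 ->
    c%:~R = - (b%:~R / a%:~R) * d%:~R :> R.
  move=> cd; apply: (mulIf aR0); rewrite mulrAC mulNr divfK// -!intrM mulNr -intrM -intrN.
  by congr _%:~R; rewrite !mulrzz in cd *; move/eqP: cd; rewrite addr_eq0 [b * _]mulrC => /eqP.
move=> _ [r _ <-]; exists (r * - (b%:~R / a%:~R)) => //.
by rewrite -!mulrA -(coord _ _ uv1) -(coord _ _ uv2).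
Qed.

Lemma lin_indep_of_dpi_gt0 (R : realType) (u v : Z2) :
  u <> 0 -> v <> 0 -> 0 < dpi (dir u) (dir v) :> R -> lin_indep u v.
Proof.
move=> u0 v0 dpi_gt0; apply: contrapT => /dependent_of_lin_indepN[a [b [ab0 uv]]].
have dir_eq : dir u = dir v :> set (R * R).
  apply/seteqP; split; first exact: (dir_sub v0 ab0 uv).
  apply: (@dir_sub R v u b a) => //; last by rewrite addrC.
  by move=> [b0 a0]; apply: ab0; rewrite a0 b0.
(* Dependent vectors span the same line, and then the term [m = 0] of the infimum vanishes,
   whichever representative [angle] picks. *)
move: dpi_gt0; rewrite dir_eq /dpi; apply/negP; rewrite -leNgt.
apply: ge_inf; first by exists 0 => _ [m _ <-]; exact: normr_ge0.
by exists 0 => //; rewrite subrr mul0r subr0 normr0.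
Qed.

(** The two recurrence vectors are linearly independent, so they cannot both be periods of an
    aperiodic [x]. *)
Lemma aperiodic_recurrence (R : realType) (A : Type) (x : Z2 -> A) (N : nat) :
  strongly_recurrent R x -> ~ doubly_periodic x -> (1 <= N)%N ->
  exists2 w : Z2, ~ Per x w & forall z, Sigma N z -> x (z + w) = x z.
Proof.
move=> [delta delta_gt0 recx] aper N1.
have [u [v [u0 v0 uvx uvd]]] := recx N N1.
have [Pu|nPu] := pselect (Per x u); last by exists u => // z /uvx[].
exists v => [Pv|z /uvx[]//]; apply: aper; exists u, v; split=> //.
exact: (lin_indep_of_dpi_gt0 u0 v0 (lt_le_trans delta_gt0 uvd)).
Qed.

Lemma Sigma_near (z : Z2) : \forall n \near \oo, Sigma n.+1 z.
Proof.
near=> n.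
have h1 : (`|z.1| <= n)%N by near: n; exact: nbhs_infty_ge.
have h2 : (`|z.2| <= n)%N by near: n; exact: nbhs_infty_ge.
by rewrite /Sigma /=; lia.
Unshelve. all: by end_near. Qed.

Lemma strongly_recurrent_ladder (R : realType) (x : Z2 -> bool) (m : nat) :
  strongly_recurrent R x -> ~ doubly_periodic x ->
  ladder (fun t s : Z2 => x (t + s)) m.
Proof.
move=> recx aper.
(* The shift to [n.+1] is there because recurrence is only given for boxes of size at least 1. *)
have /choice[w wP] (n : nat) : exists w : Z2,
    ~ Per x w /\ forall z, Sigma n.+1 z -> x (z + w) = x z.
  by have [w ? ?] := aperiodic_recurrence recx aper (ltn0Sn n); exists w.
have /choice[a aP] (n : nat) : exists a : Z2, x (a + w n) <> x a.
  by have [/existsNP[a ?] _] := wP n; exists a.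
have [U [UU subU]] := ultraFilterLemma (_ : ProperFilter (\oo : set_system nat)).
apply: (@ladder_of_recurrence Z2 nat U UU x w a m _ aP) => z.
by apply: subU; apply: filterS (Sigma_near z) => n; exact: (wP n).2.
Qed.

(** * Abelian complexity of binary configurations *)

Definition ones (I : finType) (v : {ffun I -> bool}) : nat := #|[set s | v s]%SET|.

Lemma ones_lt (I : finType) (v : {ffun I -> bool}) : (ones v < #|I|.+1)%N.
Proof. exact: max_card. Qed.

(** With two letters and a fixed window, the number of ones determines the number of zeros. *)
Lemma ab_equivE (S : {fset Z2}) (v w : {ffun S -> bool}) :
  ab_equiv v w = (ones v == ones w).
Proof.
have trueE (f : {ffun S -> bool}) : [set s | f s == true]%SET = [set s | f s]%SET.
  by apply/setP => s; rewrite !inE eqb_id.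
have falseE (f : {ffun S -> bool}) :
    #|[set s | f s == false]%SET| = (#|{: S}| - ones f)%N.
  rewrite cardsCs; congr (_ - #|pred_of_set _|)%N.
  by apply/setP => s; rewrite !inE; case: (f s).
apply/forallP/eqP => [/(_ true)|vw [|]]; rewrite ?trueE ?falseE ?vw//.
- by move/eqP.
- exact/eqP.
Qed.

Lemma pab_boolE (x : Z2 -> bool) (S : {fset Z2}) :
  pab x S = #|[set @inord #|{: S}| (ones v) | v in factors x S]%SET|.
Proof.
(* Sends a count to its Abelian class; it is injective on the counts that occur, since their blocks
   are nonempty. *)
pose block (c : 'I_#|{: S}|.+1) := [set w in factors x S | ones w == c]%SET.
have inordE (v : {ffun S -> bool}) : @inord #|{: S}| (ones v) = ones v :> nat.
  by apply: inordK; exact: ones_lt.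
rewrite /pab -(@card_in_imset _ _ block) => [|_ d /imsetP[v vx ->] _ eq_block].
  rewrite -imset_comp; congr #|pred_of_set _|; apply: eq_imset => v /=.
  by apply/setP => w; rewrite !inE ab_equivE inordE eq_sym.
have : v \in block (inord (ones v)) by rewrite inE vx inordE eqxx.
by rewrite eq_block inE => /andP[_ /eqP vd]; apply: val_inj; exact: (etrans (inordE v) vd).
Qed.

Lemma mem_factor (A : finType) (x : Z2 -> A) (S : {fset Z2}) (t : Z2) :
  Defs.factor x S t \in factors x S.
Proof. by rewrite inE; apply/asboolP; exists t. Qed.

Lemma pab_bool_le (x : Z2 -> bool) (S : {fset Z2}) : (pab x S <= #|` S|.+1)%N.
Proof.
by rewrite pab_boolE -cardfE (leq_trans (max_card _))// card_ord.
Qed.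

Lemma pab_bool_full (x : Z2 -> bool) (S : {fset Z2}) :
  (forall c, (c <= #|` S|)%N -> exists t, ones (Defs.factor x S t) = c) ->
  pab x S = #|` S|.+1.
Proof.
move=> onesS; rewrite pab_boolE -[RHS]card_ord -cardfE -cardsT.
congr #|pred_of_set _|; apply/setP => c; rewrite finset.in_setT; apply/imsetP.
have [|t tc] := onesS c; first by rewrite -ltnS ltn_ord.
by exists (Defs.factor x S t); [exact: mem_factor | rewrite tc inord_val].
Qed.

(** A factor depends only on the coset of its position modulo [Per x], so there are at most as many
    factors, and hence counts, as cosets. *)
Lemma pab_le_index (R : realType) (x : Z2 -> bool) (S : {fset Z2}) :
  ((pab x S)%:R%:E <= subgroup_index R (Per x))%E.
Proof.
rewrite /subgroup_index /counting; case: asboolP => [fin|_]; last exact: leey.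
rewrite lee_fin ler_nat.
have /choice[t tP] (v : {ffun S -> bool}) : exists t, v \in factors x S -> v = Defs.factor x S t.
  have [|vS] := boolP (v \in factors x S); last by exists 0.
  by rewrite inE => /asboolP[t ->]; exists t.
pose coset t := [set t + h | h in Per x].
have coset_factor s s' : coset s = coset s' -> Defs.factor x S s = Defs.factor x S s'.
  move=> ss'; have : coset s s by exists 0; rewrite ?addr0// => z; rewrite addr0.
  rewrite ss' => -[h Ph <-]; apply/ffunP => z; rewrite !ffunE addrAC; exact: Ph.
rewrite pab_boolE (leq_trans (leq_imset_card _ _))//.
rewrite cardE -(size_map (coset \o t)) uniq_leq_size//.
  rewrite map_inj_in_uniq ?enum_uniq// => v w; rewrite !mem_enum => vS wS vw.
  by rewrite (tP _ vS) (tP _ wS); exact: coset_factor.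
move=> _ /mapP[v _ ->]; rewrite in_fset_set//; apply/mem_set.
by exists (t v).
Qed.

(** Only the columns [s 1] to [s k] enter [S]: column 0 takes the same value on all rows. Among
    these [k] columns, row [i] has [i] entries [b] and [k - i] entries [~~ b], so the rows [0] to
    [k] realize all [k + 1] counts. *)
Lemma ladder_ones (x : Z2 -> bool) (k : nat) :
  ladder (fun t s : Z2 => x (t + s)) k.+1 ->
  exists2 S : {fset Z2}, #|` S|%fset = k &
    forall c, (c <= k)%N -> exists t, ones (Defs.factor x S t) = c.
Proof.
move=> [b [t [s xts]]].
(* For [i < j], row [i] separates columns [i] and [j]. *)
have s_inj : {in iota 1 k &, injective s}.
  move=> i j; rewrite !mem_iota add1n !ltnS => /andP[i0 ik] /andP[j0 jk] sij.
  wlog lt_ij : i j i0 ik j0 jk sij / (i < j)%N => [wlog_ij|].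
    by have [/wlog_ij->|/wlog_ij->|] := ltngtP i j.
  have := xts i i ik ik; have := xts i j ik jk.
  by rewrite sij lt_ij ltnn => ->; case: (b).
have size_s : size (map s (iota 1 k)) = k by rewrite size_map size_iota.
have uniq_s : uniq (map s (iota 1 k)) by rewrite map_inj_in_uniq ?iota_uniq.
pose S := [fset z in map s (iota 1 k)]%fset.
have onesE u : ones (Defs.factor x S u) = count (fun j => x (u + s j)) (iota 1 k).
  rewrite -(count_map s (fun z => x (u + z))) -size_filter.
  rewrite /ones cardE -(size_map (@fsval _ S)); apply: perm_size; apply: uniq_perm.
  - by rewrite map_inj_uniq ?enum_uniq//; exact: val_inj.
  - exact: filter_uniq.
  move=> z; rewrite mem_filter; apply/mapP/andP => [[z' + ->]|[xz zs]].
    by rewrite mem_enum inE ffunE => ->; have := fsvalP z'; rewrite inE.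
  have zS : z \in S by rewrite inE.
  by exists [` zS]%fset => //; rewrite mem_enum inE ffunE.
have count_lt i : (i <= k)%N -> count (fun j => (i < j)%N) (iota 1 k) = (k - i)%N.
  move=> ik; rewrite -{1}(subnKC ik) iotaD count_cat add1n.
  rewrite (eq_in_count (a2 := pred0)) ?count_pred0 => [|j].
    rewrite (eq_in_count (a2 := predT)) ?count_predT ?size_iota// => j.
    by rewrite mem_iota => /andP[].
  by rewrite mem_iota add1n ltnS => /andP[_ ji]; rewrite ltnNge ji.
exists S; first by rewrite card_fseq undup_id.
move=> c ck; pose i := if b then c else (k - c)%N.
have ik : (i <= k)%N by rewrite /i; case: (b); rewrite ?leq_subr.
exists (t i); rewrite onesE.
rewrite (eq_in_count (a2 := fun j => b (+) (i < j)%N)) => [|j]; last first.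
  by rewrite mem_iota add1n => /andP[_ jk]; exact: xts.
rewrite /i; case: (b) => /=; last by rewrite count_lt ?leq_subr// subKn.
have := count_predC (fun j => c < j)%N (iota 1 k); rewrite size_iota count_lt//.
by move=> /(congr1 (subn^~ (k - c)%N)); rewrite addKn subKn.
Qed.

Theorem theorem5p7 (R : realType) (x : Z2 -> bool)
    (hx : strongly_recurrent R x) :
  let alt_i := doubly_periodic x /\
    (forall k : nat, (0 < k)%N -> (pab_star R x k <= subgroup_index R (Per x))%E) in
  let alt_ii := ~ doubly_periodic x /\
    (forall k : nat, (0 < k)%N -> pab_star R x k = (k.+1)%:R%:E) in
  (alt_i \/ alt_ii) /\ ~ (alt_i /\ alt_ii).
Proof.
split; last by move=> [[per _] [aper _]].
have [per|aper] := pselect (doubly_periodic x); [left|right]; split=> // k _.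
  by apply: ge_ereal_sup => _ [S _ <-]; exact: pab_le_index.
apply/le_anti/andP; split.
  by apply: ge_ereal_sup => _ [S <- <-]; rewrite lee_fin ler_nat pab_bool_le.
(* A single window realizing every count from 0 to [k] already attains the supremum. *)
have [S Sk onesS] := ladder_ones (strongly_recurrent_ladder k.+1 hx aper).
apply: ereal_sup_ubound; exists S => //.
by rewrite pab_bool_full Sk.
Qed.
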